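(* Fix a random variable $R$ with $R\in(0,C]$ almost surely for some $C<\infty$, and for $\lambda>0$ let $\alpha=2\lambda\,\mathbf E[\sinh(R)]$. Let $\mathfrak V$ be the total visibility from the origin in the Poisson Boolean model in $\mathbb H^2$ with intensity $\lambda$ and radius distribution $R$. Then, as $\alpha\to0$ (that is, as $\lambda\to0$), $$\lim_{\alpha\to0}\mathbf P[\mathfrak V=\infty]=1.$$
   Context: $\mathbb H^2$ is the hyperbolic plane in the Poincaré disc model: the unit disc $\{|z|<1\}$ with metric $ds^2=4\frac{dx^2+dy^2}{(1-(x^2+y^2))^2}$ and area measure $\mu(dx,dy)=\frac{4}{(1-(x^2+y^2))^2}\,dx\,dy$. Let $X$ be a Poisson point process in $\mathbb H^2$ with intensity measure $\lambda\mu$, and let $\{R_x\}_{x\in X}$ be i.i.d. copies of $R$, independent of $X$. The occupied set is $\mathcal C=\bigcup_{x\in X}B(x,R_x)$, where $B(x,r)$ is the closed hyperbolic ball of radius $r$ centered at $x$. $L_r(\theta)$ denotes the geodesic segment of length $r$ starting at the origin whose continuation hits the boundary of the disc at $e^{i\theta}$. The visibility in direction $\theta$ is $V(\theta)=\inf\{r\ge0:L_r(\theta)\cap\mathcal C\ne\emptyset\}$ (with $\inf\emptyset=\infty$), and the total visibility is $\mathfrak V=\sup_{\theta\in[0,2\pi)}V(\theta)$. *)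

(* Defs.v *)
(* MathComp-Analysis *)
From HB Require Import structures.
From mathcomp Require Import all_boot all_order all_algebra.
From mathcomp Require Import all_classical all_reals all_analysis.
From mathcomp Require Import measurable_realfun.
Set Implicit Arguments.
Unset Strict Implicit.
Unset Printing Implicit Defensive.
Import Order.TTheory GRing.Theory Num.Theory.
Import numFieldNormedType.Exports.
Local Open Scope classical_set_scope.
Local Open Scope ring_scope.

Section HyperbolicPlane.
Context {R : realType}.
Implicit Types (z w : R * R) (g : R -> R * R) (theta r : R).

Definition sqnorm z : R := z.1 ^+ 2 + z.2 ^+ 2.

Definition disc : set (R * R) := [set z | sqnorm z < 1].

Definition hyp_area (A : set (R * R)) : \bar R :=
  (\int[lebesgue_measure \x lebesgue_measure]_(z in A `&` disc)
     (4 / (1 - sqnorm z) ^+ 2)%:E)%E.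

Definition C1 (f : R -> R) : Prop :=
  (forall t, derivable f t 1) /\ continuous (derive1 f).

(* Asking for C1 on the whole line is no restriction: a C1 function on [0, 1]
   has a C1 extension. *)
Definition C1_path z w g : Prop :=
  [/\ C1 (fst \o g), C1 (snd \o g),
      (forall t, 0 <= t <= 1 -> disc (g t)), g 0 = z & g 1 = w].

(* Length for the metric ds^2 = 4 (dx^2 + dy^2) / (1 - (x^2 + y^2))^2. *)
Definition hyp_length g : R :=
  \int[lebesgue_measure]_(t in `[0, 1])
    (2 * Num.sqrt (derive1 (fst \o g) t ^+ 2 + derive1 (snd \o g) t ^+ 2)
       / (1 - sqnorm (g t))).

Definition hyp_dist z w : R := inf [set hyp_length g | g in C1_path z w].

Definition hyp_ball z r : set (R * R) :=
  [set w | disc w /\ hyp_dist z w <= r].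

(* The unit speed geodesic ray from the origin with endpoint
   (cos theta, sin theta) on the boundary circle. *)
Definition geodesic_ray theta g : Prop :=
  [/\ g 0 = (0, 0),
      (forall t, 0 <= t -> disc (g t)),
      (forall s t, 0 <= s -> 0 <= t -> hyp_dist (g s) (g t) = `|s - t|),
      (g t).1 @[t --> +oo] --> cos theta
    & (g t).2 @[t --> +oo] --> sin theta].

Definition geodesic_segment r theta : set (R * R) :=
  [set z | exists2 g, geodesic_ray theta g
         & exists2 t, 0 <= t <= r & z = g t].

Definition visibility (C : set (R * R)) theta : \bar R :=
  ereal_inf [set r%:E | r in
    [set r | 0 <= r /\ geodesic_segment r theta `&` C !=set0]].

Definition total_visibility (C : set (R * R)) : \bar R :=
  ereal_sup [set visibility C theta | theta in `[0, 2 * pi[%classic].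

End HyperbolicPlane.

Section Probability.
Context {R : realType} {d : measure_display} {T : measurableType d}.
Variable P : probability T R.

(* Mutual independence of a family of sigma-algebras. *)
Definition mutually_independent (I : eqType) (F : I -> set_system T) : Prop :=
  forall (J : seq I) (E : I -> set T), uniq J ->
    (forall i, i \in J -> F i (E i)) ->
    P (\bigcap_(i in [set` J]) E i) = (\prod_(i <- J) P (E i))%E.

Definition sigma_sequence d' (S : measurableType d') (f : nat -> T -> S) :
    set_system T :=
  <<s \bigcup_n g_sigma_algebra_preimage (f n) >>.

Definition point_count (S : Type) (x : nat -> T -> S) (A : set S) (w : T) :
    \bar R :=
  counting [set n | A (x n w)].

(* The random counting measure of the points x 0, x 1, ... is a Poisson point
   process with intensity measure nu. *)
Definition poisson_process d' (S : measurableType d') (nu : set S -> \bar R)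
    (x : nat -> {RV P >-> S}) : Prop :=
  (forall (A : set S) (k : nat), measurable A -> (nu A < +oo)%E ->
     P [set w | point_count x A w = (k%:R)%:E] =
     (fine (nu A) ^+ k / k`!%:R * expR (- fine (nu A)))%:E) /\
  (forall A : nat -> set S, (forall i, measurable (A i)) -> trivIset setT A ->
     mutually_independent
       (fun i => g_sigma_algebra_preimage (point_count x (A i)))).

(* The points of the process are enumerated as x 0, x 1, ...; there are
   infinitely many because the hyperbolic plane has infinite area. The ball
   centered at x n has radius r n. The law of the radii is mu. *)
Definition poisson_boolean_model (lambda : R) (mu : set R -> \bar R)
    (x : nat -> {RV P >-> (R * R)%type}) (r : nat -> {RV P >-> R}) : Prop :=
  [/\ (forall n w, disc (x n w)),
      poisson_process (fun A => (lambda%:E * hyp_area A)%E) x,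
      (forall n A, measurable A -> distribution P (r n) A = mu A),
      mutually_independent (fun n => g_sigma_algebra_preimage (r n))
    & (forall E F, sigma_sequence x E -> sigma_sequence r F ->
         P (E `&` F) = (P E * P F)%E)].

Definition occupied (x : nat -> T -> R * R) (r : nat -> T -> R) (w : T) :
    set (R * R) :=
  \bigcup_n hyp_ball (x n w) (r n w).

(* Inner probability, as a measure is only meaningful on measurable sets. It
   is the (completed) probability of E when E is measurable for the
   completion of P. *)
Definition inner_prob (E : set T) : \bar R :=
  ereal_sup [set P A | A in [set A | measurable A /\ A `<=` E]].

Lemma inner_probE (E : set T) : measurable E -> inner_prob E = P E.
Proof.
move=> mE; apply/eqP; rewrite eq_le; apply/andP; split.
  apply: ge_ereal_sup => _ [A [mA AE] <-].
  by apply: le_measure => //; rewrite inE.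
by apply: ereal_sup_ubound; exists E => //; split.
Qed.

End Probability.

Definition sinh {R : realType} (x : R) : R := (expR x - expR (- x)) / 2.

Definition alpha {R : realType} {d : measure_display} {T : measurableType d}
    (P : probability T R) (rad : {RV P >-> R}) (lambda : R) : \bar R :=
  ((2 * lambda)%:E * 'E_P[sinh \o rad])%E.

(* The filter "alpha tends to 0" on the intensities lambda > 0. *)
Definition alpha_to_0 {R : realType} {d : measure_display}
    {T : measurableType d} (P : probability T R) (rad : {RV P >-> R}) :
    set_system R :=
  filter_from [set e : R | 0 < e]
    (fun e => [set lambda | 0 < lambda /\ (`|alpha rad lambda| < e%:E)%E]).

(* Main.v *)
(* Since R <= C almost surely, all radii may be replaced by C, and alpha -> 0
   amounts to lambda -> 0.

   Geometry. With delta(z, w) = |z - w|^2 / ((1 - |z|^2) (1 - |w|^2)), the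
   function ln (1 + delta(z, .)) = 2 ln cosh (d(z, .) / 2) is 1-Lipschitz, so
   exp d >= 1 + delta. Together with d(0, z) <= ln (4 / (1 - |z|^2)) this shows
   that a point z within distance C of the geodesic ray to the boundary point u
   satisfies |z - u| <= 10 e^C (1 - |z|^2); neither the explicit form of the
   geodesics nor their uniqueness is needed.

   Percolation. Boundary points u_s are indexed by binary words s, as in a
   Cantor set of ratio q. To s is attached the cell
   { z : q^(n+1) < 1 - |z|^2 <= q^n, |z - u_s|_oo <= K q^n }, n = size s. For K
   large and q small the cells are pairwise disjoint, their hyperbolic areas are
   bounded by a constant, and a point which hides u_s up to depth size s lies in
   the cell of some prefix of s. Hence the visibility is infinite as soon as,
   for all n, some word of length n has only prefixes with empty cells. The
   cells are independently nonempty with probabilities at most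
   p = O(lambda), and summing over the cutsets of the binary tree bounds the
   probability that no such word exists by f_n, where f_(n+1) = p + f_n^2, so
   that f_n <= 2 p when p <= 1/4. *)
Require Import Defs.
From HB Require Import structures.
From mathcomp Require Import all_boot all_order all_algebra.
From mathcomp Require Import all_classical all_reals all_analysis.
From mathcomp Require Import measurable_realfun.
From mathcomp Require Import ring lra.
Import Order.TTheory GRing.Theory Num.Theory.
Import numFieldNormedType.Exports.
Set Implicit Arguments.
Unset Strict Implicit.
Unset Printing Implicit Defensive.
Local Open Scope classical_set_scope.
Local Open Scope ring_scope.

(** * Estimates for the hyperbolic distance, balls and geodesic rays *)

Section Paths.
Context {R : realType}.
Implicit Types (z w : R * R) (g : R -> R * R).

Lemma FTC2_unit (F f : R -> R) :
  (forall t : R, 0 <= t <= 1 -> is_derive t (1 : R) F (f t)) ->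
  (forall t : R, 0 <= t <= 1 -> {for t, continuous f}) ->
  \int[lebesgue_measure]_(t in `[0, 1]) f t = F 1 - F 0.
Proof.
move=> dF cf; rewrite /Rintegral (@continuous_FTC2 _ f F 0 1) //.
- by apply: continuous_in_subspaceT => t; rewrite inE /= in_itv /=; apply: cf.
- have cF (t : R) : 0 <= t <= 1 -> {for t, continuous F}.
    move=> /dF dFt; apply/differentiable_continuous/derivable1_diffP.
    exact: ex_derive.
  split.
  + move=> t; rewrite in_itv /= => /andP[t0 t1].
    by apply: (@ex_derive _ _ _ _ _ _ _ (dF t _)); rewrite !ltW.
  + by apply: cvg_at_right_filter; apply: cF; rewrite lexx ler01.
  + by apply: cvg_at_left_filter; apply: cF; rewrite lexx ler01.
- move=> t; rewrite in_itv /= => /andP[t0 t1]; rewrite derive1E.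
  by apply: (@derive_val _ _ _ _ _ _ _ (dF t _)); rewrite !ltW.
Qed.

Lemma le_Rintegral_unit (f h : R -> R) :
  (forall t : R, 0 <= t <= 1 -> {for t, continuous f}) ->
  (forall t : R, 0 <= t <= 1 -> {for t, continuous h}) ->
  (forall t : R, 0 <= t <= 1 -> f t <= h t) ->
  \int[lebesgue_measure]_(t in `[0, 1]) f t <=
  \int[lebesgue_measure]_(t in `[0, 1]) h t.
Proof.
move=> cf ch fh; apply: le_Rintegral => //.
- apply: continuous_compact_integrable; first exact: segment_compact.
  by apply: continuous_in_subspaceT => t; rewrite inE /= in_itv /=; apply: cf.
- apply: continuous_compact_integrable; first exact: segment_compact.
  by apply: continuous_in_subspaceT => t; rewrite inE /= in_itv /=; apply: ch.
Qed.


(* [|1 - z^* w|^2] in complex notation *)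
Definition mobius_den z w : R :=
  1 - 2 * (z.1 * w.1 + z.2 * w.2) + sqnorm z * sqnorm w.

Definition sqdist z w : R := (z.1 - w.1) ^+ 2 + (z.2 - w.2) ^+ 2.

Lemma mobius_denE z w :
  mobius_den z w = sqdist z w + (1 - sqnorm z) * (1 - sqnorm w).
Proof. rewrite /mobius_den /sqdist /sqnorm; ring. Qed.

Lemma sqdist_ge0 z w : 0 <= sqdist z w.
Proof. by rewrite addr_ge0 // sqr_ge0. Qed.

Lemma sqnorm_ge0 z : 0 <= sqnorm z.
Proof. by rewrite addr_ge0 // sqr_ge0. Qed.

Lemma mobius_den_gt0 z w : disc z -> disc w -> 0 < mobius_den z w.
Proof.
rewrite /disc /= mobius_denE => z1 w1.
by rewrite ltr_wpDl ?sqdist_ge0// mulr_gt0 ?subr_gt0.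
Qed.

(** The left-hand side is the derivative in direction [(p, q)] of
    [ln (mobius_den z w) - ln (1 - sqnorm w)] as a function of [w], and the right-hand side is the
    hyperbolic norm of [(p, q)] at [w]. This is the Lipschitz property of [ln (1 + delta(z, .))] in
    infinitesimal form. *)
Lemma mobius_grad_le z w (p q : R) : disc z -> disc w ->
  (- 2 * (z.1 * p + z.2 * q) + 2 * sqnorm z * (w.1 * p + w.2 * q))
    / mobius_den z w + 2 * (w.1 * p + w.2 * q) / (1 - sqnorm w)
  <= 2 * Num.sqrt (p ^+ 2 + q ^+ 2) / (1 - sqnorm w).
Proof.
move=> dz dw; have N0 := mobius_den_gt0 dz dw.
have w0 : 0 < 1 - sqnorm w by rewrite subr_gt0.
have z0 : 0 < 1 - sqnorm z by rewrite subr_gt0.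
have := mobius_denE z w.
set N := mobius_den z w in N0 * => NE.
pose c := 1 + sqnorm z - 2 * (z.1 * w.1 + z.2 * w.2).
pose u1 := (w.1 * c - z.1 * (1 - sqnorm w)) / N.
pose u2 := (w.2 * c - z.2 * (1 - sqnorm w)) / N.
have uE : (- 2 * (z.1 * p + z.2 * q) + 2 * sqnorm z * (w.1 * p + w.2 * q))
    / N + 2 * (w.1 * p + w.2 * q) / (1 - sqnorm w)
    = 2 * (u1 * p + u2 * q) / (1 - sqnorm w).
  have cE : c = N + sqnorm z * (1 - sqnorm w).
    by rewrite /N /mobius_den /c; ring.
  rewrite /u1 /u2 cE; field.
  by rewrite !gt_eqF.
rewrite uE ler_pM2r ?invr_gt0// ler_pM2l// (le_trans (ler_norm _))//.
rewrite -sqrtr_sqr ler_wsqrtr//.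
(* The left-hand side is the pairing of [(p, q)] with [2 / (1 - |w|^2) * u], and
   [|u|^2 = |z - w|^2 / mobius_den z w = tanh^2 (d(z, w) / 2)]. *)
have uu : u1 ^+ 2 + u2 ^+ 2 <= 1.
  have -> : u1 ^+ 2 + u2 ^+ 2 = sqdist z w / N.
    have E : (w.1 * c - z.1 * (1 - sqnorm w)) ^+ 2
            + (w.2 * c - z.2 * (1 - sqnorm w)) ^+ 2 = N * sqdist z w.
      by rewrite /N /mobius_den /c /sqdist /sqnorm; ring.
    rewrite /u1 /u2 !expr_div_n -mulrDl E expr2; field.
    by rewrite gt_eqF.
  by rewrite ler_pdivrMr// mul1r NE lerDl mulr_ge0// ltW.
have CS : (u1 * p + u2 * q) ^+ 2 = (u1 ^+ 2 + u2 ^+ 2) * (p ^+ 2 + q ^+ 2)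
   - (u1 * q - u2 * p) ^+ 2 by ring.
rewrite CS lerBlDr (le_trans (ler_piMl _ uu)) ?addr_ge0 ?sqr_ge0//.
by rewrite lerDl sqr_ge0.
Qed.

(* [1 + delta(z, w) = mobius_den z w / ((1 - |z|^2) (1 - |w|^2))] *)
Lemma hyp_length_ge z w g : disc z -> C1_path z w g ->
  ln (mobius_den z w / ((1 - sqnorm z) * (1 - sqnorm w))) <= hyp_length g.
Proof.
move=> dz [[da ca] [db cb] dg g0 g1].
pose a : R -> R := fst \o g; pose b : R -> R := snd \o g.
have dw : disc w by rewrite -g1; apply: dg; rewrite lexx ler01.
have w0 : 0 < 1 - sqnorm w by rewrite subr_gt0.
have z0 : 0 < 1 - sqnorm z by rewrite subr_gt0.
have Da (t : R) : is_derive t (1 : R) a (derive1 a t).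
  by rewrite derive1E; apply: derivableP; exact: da.
have Db (t : R) : is_derive t (1 : R) b (derive1 b t).
  by rewrite derive1E; apply: derivableP; exact: db.
have Ca (t : R) : {for t, continuous a}.
  by apply/differentiable_continuous/derivable1_diffP; exact: da.
have Cb (t : R) : {for t, continuous b}.
  by apply/differentiable_continuous/derivable1_diffP; exact: db.
pose n (t : R) : R := mobius_den z (a t, b t).
pose m (t : R) : R := 1 - sqnorm (a t, b t).
pose a' := derive1 a; pose b' := derive1 b.
pose n' (t : R) : R := - 2 * (z.1 * a' t + z.2 * b' t)
  + 2 * sqnorm z * (a t * a' t + b t * b' t).
pose m' (t : R) : R := 2 * (a t * a' t + b t * b' t).
have gE (t : R) : g t = (a t, b t) by rewrite /a /b /=; case: (g t).
have n0 (t : R) : 0 <= t <= 1 -> 0 < n t.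
  by move=> /dg; rewrite gE => ?; exact: mobius_den_gt0.
have m0 (t : R) : 0 <= t <= 1 -> 0 < m t.
  by move=> /dg; rewrite gE /disc /= -subr_gt0.
have Dn (t : R) : is_derive t (1 : R) n (n' t).
  have := Da t; have := Db t => Dbt Dat.
  rewrite /n /mobius_den /sqnorm /=.
  apply: is_derive_eq; rewrite /n' /sqnorm /GRing.scale /= /a' /b'; ring.
have Dm (t : R) : is_derive t (1 : R) m (- m' t).
  have := Da t; have := Db t => Dbt Dat.
  rewrite /m /sqnorm /=.
  apply: is_derive_eq; rewrite /m' /GRing.scale /= /a' /b'; ring.
have Cn (t : R) : {for t, continuous n}.
  by apply/differentiable_continuous/derivable1_diffP; exact: ex_derive.
have Cm (t : R) : {for t, continuous m}.
  by apply/differentiable_continuous/derivable1_diffP; exact: ex_derive.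
(* Up to the constant [ln (1 - sqnorm z)], [F t] is [ln (1 + delta(z, g t))]; its derivative is at
   most the speed of [g]. *)
pose F t : R := ln (n t) - ln (m t).
pose f t : R := n' t / n t + m' t / m t.
have DF (t : R) : 0 <= t <= 1 -> is_derive t (1 : R) F (f t).
  move=> t01.
  have L1 := is_derive1_ln (n0 t t01); have L2 := is_derive1_ln (m0 t t01).
  have Dnt := Dn t; have Dmt := Dm t.
  have D1 : is_derive t (1 : R) (@ln R \o n) ((n t)^-1 * n' t)
    by exact: is_derive1_comp.
  have D2 : is_derive t (1 : R) (@ln R \o m) ((m t)^-1 * - m' t)
    by exact: is_derive1_comp.
  rewrite (_ : F = (@ln R \o n) - (@ln R \o m)) //.
  by apply: is_derive_eq; rewrite /f; ring.
have Cm' (t : R) : {for t, continuous m'}.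
  apply: (@cvgM _ _ _ _ (fun _ => 2)); first exact: cvg_cst.
  by apply: cvgD; apply: cvgM; [exact: Ca|exact: ca|exact: Cb|exact: cb].
have Cn' (t : R) : {for t, continuous n'}.
  apply: cvgD.
    apply: (@cvgM _ _ _ _ (fun _ => - 2)); first exact: cvg_cst.
    apply: cvgD.
      by apply: (@cvgM _ _ _ _ (fun _ => z.1)); [exact: cvg_cst|exact: ca].
    by apply: (@cvgM _ _ _ _ (fun _ => z.2)); [exact: cvg_cst|exact: cb].
  apply: (@cvgM _ _ _ _ (fun _ => 2 * sqnorm z)); first exact: cvg_cst.
  by apply: cvgD; apply: cvgM; [exact: Ca|exact: ca|exact: Cb|exact: cb].
have F01 : F 1 - F 0 = ln (mobius_den z w / ((1 - sqnorm z) * (1 - sqnorm w))).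
  rewrite /F /n /m -!gE g0 g1.
  have -> : mobius_den z z = (1 - sqnorm z) ^+ 2.
    by rewrite mobius_denE /sqdist /sqnorm; ring.
  rewrite lnXn// ln_div ?posrE ?mulr_gt0 ?mobius_den_gt0// lnM ?posrE//.
  by rewrite mulr2n; ring.
rewrite -F01 -(FTC2_unit DF).
  apply: le_Rintegral_unit.
  - move=> t t01; apply: cvgD; apply: cvgM; [exact: Cn'| |exact: Cm'|].
      by apply: cvgV; [rewrite gt_eqF// n0|exact: Cn].
    by apply: cvgV; [rewrite gt_eqF// m0|exact: Cm].
  - move=> t t01; apply: cvgM.
      apply: (@cvgM _ _ _ _ (fun _ => 2)); first exact: cvg_cst.
      apply: continuous_comp; last exact: sqrt_continuous.
      apply: cvgD; rewrite /=.
        by rewrite /GRing.exp /=; apply: cvgM; exact: ca.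
      by rewrite /GRing.exp /=; apply: cvgM; exact: cb.
    apply: cvgV; first by rewrite subr_eq0 gt_eqF//; apply: dg.
    rewrite (_ : (fun t => _) = m); last by apply/funext => s; rewrite gE.
    by rewrite gE; exact: Cm.
  - move=> t t01; rewrite /f /n /n' /m' /m.
    have := @mobius_grad_le z (a t, b t) (a' t) (b' t) dz.
    by rewrite -gE; apply; apply: dg.
move=> t t01; apply: cvgD; apply: cvgM; [exact: Cn'| |exact: Cm'|].
  by apply: cvgV; [rewrite gt_eqF// n0|exact: Cn].
by apply: cvgV; [rewrite gt_eqF// m0|exact: Cm].
Qed.

Lemma is_derive_affine (a b t : R) : is_derive t (1 : R) (fun s => a + s * b) b.
Proof. by apply: is_derive_eq; rewrite /GRing.scale /=; ring. Qed.

Lemma derive1_affine (a b : R) : derive1 (fun s : R => a + s * b) = cst b.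
Proof.
apply/funext => t; rewrite derive1E.
by have D := is_derive_affine a b t; exact: derive_val.
Qed.

Lemma C1_affine (a b : R) : C1 (fun s => a + s * b).
Proof.
split=> [t|]; first by have D := is_derive_affine a b t; exact: ex_derive.
by rewrite derive1_affine => t; exact: cvg_cst.
Qed.

Lemma affine_continuous (a b : R) : continuous (fun s : R => a + s * b).
Proof.
move=> t; apply/differentiable_continuous/derivable1_diffP.
by have D := is_derive_affine a b t; exact: ex_derive.
Qed.

(** The Euclidean segment shows that some path joins any two points of the disc and, when started at
    the origin, bounds the distance from above. *)
Definition straight_path z w (t : R) : R * R :=
  (z.1 + t * (w.1 - z.1), z.2 + t * (w.2 - z.2)).

Lemma C1_straight_path z w : disc z -> disc w ->
  C1_path z w (straight_path z w).
Proof.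
rewrite /disc /= => dz dw; split; try exact: C1_affine.
- move=> t /andP[t0 t1]; rewrite /disc /=.
  have -> : sqnorm (straight_path z w t) = (1 - t) * sqnorm z + t * sqnorm w
    - t * (1 - t) * sqdist z w by rewrite /sqnorm /sqdist /=; ring.
  apply: (@le_lt_trans _ _ ((1 - t) * sqnorm z + t * sqnorm w)).
    by rewrite gerBl !mulr_ge0 ?subr_ge0 ?sqdist_ge0.
  move: t0; rewrite le_eqVlt => /predU1P[<-|t0]; first lra.
  have : 0 <= (1 - t) * (1 - sqnorm z) by rewrite mulr_ge0 ?subr_ge0// ltW.
  have : 0 < t * (1 - sqnorm w) by rewrite mulr_gt0 ?subr_gt0.
  lra.
- by rewrite /straight_path !mul0r !addr0; case: z {dz}.
- by rewrite /straight_path !mul1r ![_ + (_ - _)]addrC !subrK; case: w {dw}.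
Qed.

(** This is [exp d >= 1 + delta] cleared of denominators; the bound on lengths passes to the
    infimum. *)
Lemma hyp_dist_ge z w : disc z -> disc w ->
  mobius_den z w <=
  expR (hyp_dist z w) * ((1 - sqnorm z) * (1 - sqnorm w)).
Proof.
move=> dz dw.
have w0 : 0 < 1 - sqnorm w by rewrite subr_gt0.
have z0 : 0 < 1 - sqnorm z by rewrite subr_gt0.
rewrite -ler_pdivrMr ?mulr_gt0//.
rewrite -[leLHS]lnK ?posrE ?divr_gt0 ?mulr_gt0 ?mobius_den_gt0// ler_expR.
(* The infimum of the empty set is [0] by default, so a path has to be exhibited. *)
apply: lb_le_inf.
  exists (hyp_length (straight_path z w)); exists (straight_path z w) => //.
  exact: C1_straight_path.
by move=> _ [g Cg <-]; exact: hyp_length_ge.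
Qed.

Lemma hyp_dist_le_length z w g : disc z -> C1_path z w g ->
  hyp_dist z w <= hyp_length g.
Proof.
move=> dz Cg; apply: ge_inf; last by exists g.
exists (ln (mobius_den z w / ((1 - sqnorm z) * (1 - sqnorm w)))).
by move=> _ [h Ch <-]; exact: hyp_length_ge.
Qed.

Lemma disc0 : disc (0 : R, 0 : R).
Proof. by rewrite /disc /sqnorm /= expr0n addr0. Qed.

(** With [s = |z|], the Euclidean radius to [z] has length [ln ((1 + s) / (1 - s))], and multiplying
    [(1 + s) / (1 - s)] by [1 - s^2] leaves [(1 + s)^2 <= 4]. *)
Lemma hyp_dist0_le z : disc z ->
  expR (hyp_dist (0, 0) z) * (1 - sqnorm z) <= 4.
Proof.
move=> dz; have z0 : 0 < 1 - sqnorm z by rewrite subr_gt0.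
pose s := Num.sqrt (sqnorm z).
have s0 : 0 <= s by exact: sqrtr_ge0.
have ss : s ^+ 2 = sqnorm z by rewrite sqr_sqrtr// sqnorm_ge0.
have s1 : s < 1 by rewrite -(@ltr_pXn2r _ 2) ?nnegrE// ss expr1n.
pose F (t : R) := ln (1 + t * s) - ln (1 + t * - s).
pose f (t : R) := 2 * s / (1 - sqnorm (straight_path (0, 0) z t)).
have pos (t : R) : 0 <= t <= 1 -> 0 < 1 + t * s /\ 0 < 1 + t * - s.
  move=> /andP[t0 t1]; have ts0 := mulr_ge0 t0 s0.
  have ts1 : t * s <= s by rewrite ler_piMl.
  by split; lra.
have sqE t : sqnorm (straight_path (0, 0) z t) = t ^+ 2 * s ^+ 2.
  by rewrite ss /sqnorm /=; ring.
have DF (t : R) : 0 <= t <= 1 -> is_derive t (1 : R) F (f t).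
  move=> t01; have [p1 p2] := pos t t01.
  have L1 := is_derive1_ln p1; have L2 := is_derive1_ln p2.
  have Dnt := is_derive_affine 1 s t; have Dmt := is_derive_affine 1 (- s) t.
  have D1 : is_derive t (1 : R) (@ln R \o (fun t => 1 + t * s))
    ((1 + t * s)^-1 * s) by exact: is_derive1_comp.
  have D2 : is_derive t (1 : R) (@ln R \o (fun t => 1 + t * - s))
    ((1 + t * - s)^-1 * - s) by exact: is_derive1_comp.
  rewrite (_ : F = (@ln R \o (fun t => 1 + t * s)) -
    (@ln R \o (fun t => 1 + t * - s))) //.
  apply: is_derive_eq; rewrite /f sqE.
  have -> : 1 - t ^+ 2 * s ^+ 2 = (1 + t * s) * (1 + t * - s) by ring.
  by field; rewrite !gt_eqF.
have cf (t : R) : 0 <= t <= 1 -> {for t, continuous f}.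
  move=> t01; apply: (@cvgM _ _ _ _ (fun _ => 2 * s)); first exact: cvg_cst.
  have E u : 1 - sqnorm (straight_path (0, 0) z u) =
      (1 + u * s) * (1 + u * - s).
    by rewrite sqE; ring.
  apply: cvgV.
    by rewrite E; have [p1 p2] := pos t t01; rewrite mulf_neq0// gt_eqF.
  rewrite (_ : (fun _ => _) = (fun t => (1 + t * s) * (1 + t * - s))).
    rewrite E; apply: cvgM; exact: affine_continuous.
  by apply/funext.
have len : hyp_length (straight_path (0, 0) z) = F 1 - F 0.
  rewrite -(FTC2_unit DF cf); apply: eq_Rintegral => t _.
  have -> : fst \o straight_path (0, 0) z = (fun t => 0 + t * (z.1 - 0)) by [].
  have -> : snd \o straight_path (0, 0) z = (fun t => 0 + t * (z.2 - 0)) by [].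
  by rewrite !derive1_affine !subr0.
have := hyp_dist_le_length disc0 (C1_straight_path disc0 dz).
rewrite len -ler_expR => H.
apply: (le_trans (ler_wpM2r (ltW z0) H)).
rewrite /F !mul0r !addr0 ln1 !subr0 !mul1r.
rewrite expRD expRN !lnK ?posrE; [|lra..].
rewrite -ss; have -> : 1 - s ^+ 2 = (1 - s) * (1 + s) by ring.
rewrite mulrA divfK; last by rewrite subr_eq0 gt_eqF.
have := ltW s1; have : 0 <= 1 + s by lra.
by nra.
Qed.

(** Both bounds come from [exp d >= 1 + delta]. From the origin it gives
    [exp s >= 1 / (1 - |g s|^2)]. Between [g s] and [g t] it bounds [|g s - g t|^2] by
    [exp (t - s) (1 - |g s|^2) (1 - |g t|^2)], where [exp t (1 - |g t|^2) <= 4]; then [t] tends to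
    infinity. *)
Lemma geodesic_ray_bounds theta g s : geodesic_ray theta g -> 0 <= s ->
  sqdist (g s) (cos theta, sin theta) <= 4 * (1 - sqnorm (g s)) ^+ 2 /\
  expR (- s) <= 1 - sqnorm (g s).
Proof.
move=> [g0 dg dist cx cy] s0.
have As : 0 < 1 - sqnorm (g s) by rewrite subr_gt0; exact: dg.
have dist0 t : 0 <= t -> hyp_dist (0, 0) (g t) = t.
  by move=> t0; rewrite -g0 dist// sub0r normrN ger0_norm.
have es : expR (- s) <= 1 - sqnorm (g s).
  have := hyp_dist_ge disc0 (dg s s0).
  rewrite (dist0 _ s0) expRN.
  have -> : mobius_den (0, 0) (g s) = 1.
    by rewrite /mobius_den /sqnorm /=; ring.
  have -> : sqnorm (0 : R, 0 : R) = 0 by rewrite /sqnorm /= expr0n addr0.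
  rewrite subr0 mul1r => H.
  by rewrite -[leLHS]mul1r ler_pdivrMr ?expR_gt0// mulrC.
split=> //.
have far : \forall t \near +oo,
    sqdist (g s) (g t) <= 4 * (1 - sqnorm (g s)) ^+ 2.
  near=> t.
  have st : s <= t by near: t; apply: nbhs_pinfty_ge; exact: num_real.
  have t0 := le_trans s0 st.
  have At : 0 < 1 - sqnorm (g t) by rewrite subr_gt0; exact: dg.
  have := hyp_dist_ge (dg s s0) (dg t t0).
  rewrite mobius_denE dist// distrC ger0_norm ?subr_ge0// expRD => H.
  have := hyp_dist0_le (dg t t0).
  rewrite (dist0 _ t0) => H4.
  have : expR (- s) * (1 - sqnorm (g s)) * (expR t * (1 - sqnorm (g t)))
      <= expR (- s) * (1 - sqnorm (g s)) * 4.
    by rewrite ler_wpM2l// mulr_ge0 ?expR_ge0// ltW.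
  have : expR (- s) * (1 - sqnorm (g s)) <= (1 - sqnorm (g s)) ^+ 2.
    by rewrite expr2 ler_wpM2r// ltW.
  have : 0 < (1 - sqnorm (g s)) * (1 - sqnorm (g t)) by rewrite mulr_gt0.
  by move=> *; lra.
have cd : sqdist (g s) (g t) @[t --> +oo] -->
    sqdist (g s) (cos theta, sin theta).
  rewrite /sqdist /GRing.exp /=.
  by apply: cvgD; apply: cvgM; apply: cvgB => //; exact: cvg_cst.
exact: cvgr_to_le cd far.
Unshelve. all: by end_near.
Qed.

(** Since [mobius_den z w >= (1 - |z| |w|)^2 >= (1 - |w|)^2 >= (1 - |w|^2)^2 / 4], cancelling one
    factor [1 - |w|^2] gives the first bound. The second follows from it and
    [sqdist z w <= mobius_den z w]. *)
Lemma hyp_ball_bounds z w (c : R) : disc z -> disc w -> hyp_dist z w <= c ->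
  1 - sqnorm w <= 4 * expR c * (1 - sqnorm z) /\
  sqdist z w <= (2 * expR c * (1 - sqnorm z)) ^+ 2.
Proof.
move=> dz dw dc.
have w0 : 0 < 1 - sqnorm w by rewrite subr_gt0.
have z0 : 0 < 1 - sqnorm z by rewrite subr_gt0.
have H : mobius_den z w <= expR c * ((1 - sqnorm z) * (1 - sqnorm w)).
  rewrite (le_trans (hyp_dist_ge dz dw))// ler_wpM2r ?ler_expR//.
  by rewrite mulr_ge0// ltW.
have den : (1 - sqnorm w) ^+ 2 <= 4 * mobius_den z w.
  pose k := Num.sqrt (sqnorm z); pose h := Num.sqrt (sqnorm w).
  have k0 : 0 <= k by exact: sqrtr_ge0.
  have kk : k ^+ 2 = sqnorm z by rewrite sqr_sqrtr// sqnorm_ge0.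
  have k1 : k <= 1 by rewrite -(@ler_pXn2r _ 2) ?nnegrE// kk expr1n ltW.
  have h0 : 0 <= h by exact: sqrtr_ge0.
  have hh : h ^+ 2 = sqnorm w by rewrite sqr_sqrtr// sqnorm_ge0.
  have h1 : h <= 1 by rewrite -(@ler_pXn2r _ 2) ?nnegrE// hh expr1n ltW.
  have CS : z.1 * w.1 + z.2 * w.2 <= k * h.
    rewrite (le_trans (ler_norm _))// -ler_sqr ?nnegrE ?mulr_ge0//.
    rewrite real_normK ?num_real// exprMn kk hh.
    rewrite -subr_ge0 (_ : _ - _ = (z.1 * w.2 - z.2 * w.1) ^+ 2) ?sqr_ge0//.
    by rewrite /sqnorm; ring.
  rewrite (@le_trans _ _ (4 * (1 - k * h) ^+ 2))//; last first.
    by rewrite ler_pM2l// /mobius_den -kk -hh; lra.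
  rewrite -hh (_ : 1 - h ^+ 2 = (1 + h) * (1 - h)); last by ring.
  rewrite exprMn ler_pM ?sqr_ge0//.
    have -> : 4 = 2 ^+ 2 :> R by ring.
    by rewrite ler_sqr ?nnegrE; lra.
  have kh : k * h <= h by rewrite ler_piMl.
  by rewrite ler_sqr ?nnegrE; lra.
have B : 1 - sqnorm w <= 4 * expR c * (1 - sqnorm z).
  by rewrite -(ler_pM2r w0) -expr2 (le_trans den)//; lra.
split=> //; have := H; rewrite mobius_denE => H'.
have : expR c * (1 - sqnorm z) * (1 - sqnorm w) <=
    expR c * (1 - sqnorm z) * (4 * expR c * (1 - sqnorm z)).
  by rewrite ler_wpM2l// mulr_ge0 ?expR_ge0// ltW.
have : 0 < (1 - sqnorm z) * (1 - sqnorm w) by rewrite mulr_gt0.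
by move=> *; lra.
Qed.


Lemma sqdist_le z w (e : R) : 0 <= e -> sqdist z w <= e ^+ 2 ->
  `|z.1 - w.1| <= e /\ `|z.2 - w.2| <= e.
Proof.
move=> e0 H; have := sqr_ge0 (z.1 - w.1); have := sqr_ge0 (z.2 - w.2).
move: H; rewrite /sqdist => H ? ?.
by split; rewrite -ler_sqr ?nnegrE// real_normK ?num_real//; lra.
Qed.

(** The constant [10] is [2 + 8]: [2 exp c (1 - |z|^2)] bounds the step from [z] to [g s], and
    [2 (1 - |g s|^2) <= 8 exp c (1 - |z|^2)] the step from [g s] to the endpoint. *)
Lemma hyp_ball_shadow theta g s z (c : R) : geodesic_ray theta g -> 0 <= s ->
  disc z -> hyp_dist z (g s) <= c ->
  [/\ expR (- s) <= 4 * expR c * (1 - sqnorm z),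
      `|z.1 - cos theta| <= 10 * expR c * (1 - sqnorm z) &
      `|z.2 - sin theta| <= 10 * expR c * (1 - sqnorm z)].
Proof.
move=> ray s0 dz dc; have dgs : disc (g s) by case: ray => _ + _ _ _; apply.
have z0 : 0 < 1 - sqnorm z by rewrite subr_gt0.
have g0 : 0 < 1 - sqnorm (g s) by rewrite subr_gt0.
have e0 := expR_gt0 c.
have [far es] := geodesic_ray_bounds ray s0.
have [near zg] := hyp_ball_bounds dz dgs dc.
have p0 : 0 < expR c * (1 - sqnorm z) by rewrite mulr_gt0.
have [|a1 a2] := sqdist_le _ zg; first by lra.
have [||b1 b2] := @sqdist_le (g s) (cos theta, sin theta)
  (2 * (1 - sqnorm (g s))).
- by lra.
- by rewrite exprMn (_ : 2 ^+ 2 = 4)// -natrX.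
split; first exact: le_trans near.
- apply: (le_trans (ler_distD (g s).1 _ _)).
  by apply: (le_trans (lerD a1 b1)); lra.
- apply: (le_trans (ler_distD (g s).2 _ _)).
  by apply: (le_trans (lerD a2 b2)); lra.
Qed.

End Paths.

(** * A Cantor set of boundary points indexed by binary words *)

Section Tree.
Context {R : realType} (q : R).
Implicit Types s t : seq bool.

(* The boundary point attached to the word [s] is [(width s, height s)]. *)
Fixpoint height s : R :=
  if s is b :: s' then b%:R / 4 + q * height s' else 0.

Lemma height_bounds s : 0 < q -> q <= 1 / 16 -> 0 <= height s <= 1 / 2.
Proof.
move=> q0 q1; elim: s => [|b s /andP[h0 h1]] /=; first lra.
have : 0 <= q * height s by rewrite mulr_ge0// ltW.
have : q * height s <= 1 / 16 * (1 / 2) by rewrite ler_pM// ltW.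
by case: b => /= *; lra.
Qed.

Lemma height_cat s t : height (s ++ t) = height s + q ^+ size s * height t.
Proof.
by elim: s => [|b s IH] /=; rewrite ?IH ?exprS; ring.
Qed.

(** Different first letters put the heights at least [1/4 - 1/32] apart, whereas [2 K q^n < 1/8] for
    [n >= 1]. A common first letter scales both sides by [q]. *)
Lemma height_sep (K : R) s t : 0 < q -> 1 <= K -> 16 * K * q < 1 ->
  size s = size t -> s != t -> 2 * K * q ^+ size s < `|height s - height t|.
Proof.
move=> q0 K1 Kq; have q1 : q <= 1 / 16.
  by have : q <= K * q; [rewrite ler_peMl// ltW|lra].
have small n : 2 * K * q ^+ n.+1 < 1 / 8.
  have qn : q ^+ n <= 1 by apply: exprn_ile1; rewrite ?ltW//; lra.
  have : K * q * q ^+ n <= K * q * 1 by rewrite ler_wpM2l// mulr_ge0//; lra.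
  by rewrite exprS; lra.
elim: s t => [|b s IH] [|c t]//= [st].
have /andP[s0 s1] := height_bounds s q0 q1.
have /andP[t0 t1] := height_bounds t q0 q1.
have ss0 : 0 <= q * height s by rewrite mulr_ge0// ltW.
have tt0 : 0 <= q * height t by rewrite mulr_ge0// ltW.
have ss1 : q * height s <= 1 / 16 * (1 / 2) by rewrite ler_pM// ltW.
have tt1 : q * height t <= 1 / 16 * (1 / 2) by rewrite ler_pM// ltW.
rewrite eqseq_cons negb_and => /orP[bc|]; last first.
  have [->|bc] := eqVneq b c; last first.
    move=> _; rewrite (lt_trans (small _))// ltr_normr.
    by case: b c bc => -[]//= _; apply/orP; [left|right]; lra.
  move=> /(IH _ st) H.
  rewrite opprD addrACA subrr add0r -mulrBr normrM gtr0_norm// exprS.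
  by rewrite mulrCA ltr_pM2l.
rewrite (lt_trans (small _))// ltr_normr.
by case: b c bc => -[]//= _; apply/orP; [left|right]; lra.
Qed.

Definition width s : R := Num.sqrt (1 - height s ^+ 2).

(** On the unit circle the differences of widths and of heights are inversely proportional to the
    sums; heights at most [1/2] make the sum of heights at most [1] and that of widths at least
    [1]. *)
Lemma width_lip s t : 0 < q -> q <= 1 / 16 ->
  `|width s - width t| <= `|height s - height t|.
Proof.
move=> q0 q1.
have /andP[s0 s1] := height_bounds s q0 q1.
have /andP[t0 t1] := height_bounds t q0 q1.
have W u : 1 / 2 <= width u /\ width u ^+ 2 = 1 - height u ^+ 2.
  have /andP[u0 u1] := height_bounds u q0 q1.
  have : height u ^+ 2 <= (1 / 2) ^+ 2 by rewrite ler_sqr ?nnegrE//; lra.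
  move=> hu; rewrite /width sqr_sqrtr; last by lra.
  split=> //; rewrite -ler_sqr ?nnegrE ?sqrtr_ge0//.
  by rewrite sqr_sqrtr; lra.
have [ws ws2] := W s; have [wt wt2] := W t.
have E : (width s - width t) * (width s + width t) =
    (height t - height s) * (height t + height s).
  by have -> : (width s - width t) * (width s + width t) =
    width s ^+ 2 - width t ^+ 2 by [ring]; rewrite ws2 wt2; ring.
have : `|width s - width t| * (width s + width t) <= `|height s - height t|.
  rewrite -[X in _ * X <= _]ger0_norm ?addr_ge0; [|lra..].
  rewrite -normrM E normrM distrC ler_piMr// ger0_norm; lra.
apply: le_trans; rewrite ler_peMr//; lra.
Qed.

End Tree.

(** * Cells: disjointness, covering and area *)

Section Cells.
Context {R : realType} (q K : R).
Implicit Types s t : seq bool.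

Definition cell s : set (R * R) :=
  [set z | [/\ q ^+ (size s).+1 < 1 - sqnorm z <= q ^+ size s,
     `|z.1 - width q s| <= K * q ^+ size s &
     `|z.2 - height q s| <= K * q ^+ size s]].

(** The shell containing [z] determines the length of the word; among words of that length,
    [height_sep] keeps the windows for [z.2] disjoint. *)
Lemma cell_inj s t z : 0 < q -> 1 <= K -> 16 * K * q < 1 ->
  cell s z -> cell t z -> s = t.
Proof.
move=> q0 K1 Kq [/andP[zs1 zs2] _ zs3] [/andP[zt1 zt2] _ zt3].
have q1 : q <= 1 by have : q <= K * q; [rewrite ler_peMl// ltW|lra].
have shell m n (v : R) : q ^+ m.+1 < v -> v <= q ^+ n -> (n <= m)%N.
  move=> vm vn; rewrite leqNgt; apply/negP => mn.
  have : q ^+ n <= q ^+ m.+1 by rewrite ler_wiXn2l// ltW.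
  by move=> ?; lra.
have st : size s = size t.
  by apply/eqP; rewrite eqn_leq (shell _ _ _ zt1 zs2) (shell _ _ _ zs1 zt2).
apply/eqP/negP => /negP nst.
have := height_sep q0 K1 Kq st nst.
have := ler_distD z.2 (height q s) (height q t).
rewrite [`|height q s - z.2|]distrC -st in zt3 * => ? ?; lra.
Qed.

(** The word is cut at the index [n] of the shell containing [z]. This moves the height, hence also
    the width, by at most [q^n], which is what the [1] in [k + 1 <= K] pays for. *)
Lemma cell_cover s z (k : R) : 0 < q -> q <= 1 / 16 -> k + 1 <= K ->
  0 <= k -> disc z -> q ^+ (size s).+1 < 1 - sqnorm z ->
  `|z.1 - width q s| <= k * (1 - sqnorm z) ->
  `|z.2 - height q s| <= k * (1 - sqnorm z) ->
  exists2 n, (n <= size s)%N & cell (take n s) z.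
Proof.
move=> q0 q1 kK k0 dz zs z1 z2.
have [n ns /andP[zn1 zn2]] : exists2 n, (n <= size s)%N &
    q ^+ n.+1 < 1 - sqnorm z <= q ^+ n.
  have v1 : 1 - sqnorm z <= 1 by rewrite gerBl sqnorm_ge0.
  elim: (size s) zs => [|m IH] zs; first by exists 0%N; rewrite ?expr0 ?zs.
  have [H|H] := ltP (q ^+ m.+1) (1 - sqnorm z).
    by have [n nm Hn] := IH H; exists n => //; exact: leqW.
  by exists m.+1; rewrite ?zs.
have ts : size (take n s) = n by rewrite size_takel.
have qn0 : 0 <= q ^+ n by rewrite exprn_ge0// ltW.
have dy : `|height q s - height q (take n s)| <= q ^+ n.
  rewrite -{1}(cat_take_drop n s) height_cat ts addrAC subrr add0r.
  rewrite normrM ger0_norm//.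
  have /andP[h0 h1] := height_bounds (drop n s) q0 q1.
  by rewrite ler_piMr// ger0_norm//; lra.
have kz : k * (1 - sqnorm z) <= k * q ^+ n by rewrite ler_wpM2l.
have Kz : (k + 1) * q ^+ n <= K * q ^+ n by rewrite ler_wpM2r.
exists n => //; split; rewrite ts ?zn1//.
- apply: (le_trans (ler_distD (width q s) _ _)).
  have := width_lip s (take n s) q0 q1; lra.
- apply: (le_trans (ler_distD (height q s) _ _)); lra.
Qed.

Lemma measurable_sqnorm : measurable_fun [set: R * R] (@sqnorm R).
Proof.
by apply: measurable_funD; apply: measurable_funX;
  [exact: measurable_fst|exact: measurable_snd].
Qed.

Definition cell_box s : set (R * R) :=
  `[width q s - K * q ^+ size s, width q s + K * q ^+ size s]%classic `*`
  `[height q s - K * q ^+ size s, height q s + K * q ^+ size s]%classic.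

Lemma cellE s : cell s = cell_box s `&`
  ((fun z => 1 - sqnorm z) @^-1` `]q ^+ (size s).+1, q ^+ size s]%classic).
Proof.
apply/seteqP; split=> z; rewrite /cell /cell_box /= !in_itv /= !ler_distl.
  by move=> [-> -> ->].
by move=> [[-> ->] ->].
Qed.

Lemma measurable_cell_box s : measurable (cell_box s).
Proof. by apply: measurableX. Qed.

Lemma measurable_cell s : measurable (cell s).
Proof.
rewrite cellE; apply: measurableI; first exact: measurable_cell_box.
rewrite -[X in measurable X]setTI.
by apply: (measurable_funB _ measurable_sqnorm) => //; exact: measurable_cst.
Qed.

Lemma measurable_disc : measurable (@disc R).
Proof.
rewrite (_ : disc = setT `&` @sqnorm R @^-1` `]-oo, 1[%classic).
  by apply: measurable_sqnorm.
by rewrite setTI; apply/seteqP; split=> z; rewrite /disc /= in_itv.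
Qed.

Lemma lebesgue2_cell_box s : 0 < q -> 0 <= K ->
  (lebesgue_measure \x lebesgue_measure)%E (cell_box s) =
  ((2 * (K * q ^+ size s)) ^+ 2)%:E.
Proof.
move=> q0 K0; have Kq0 : 0 <= K * q ^+ size s.
  by rewrite mulr_ge0// exprn_ge0// ltW.
have L (a b : R) : 0 <= b ->
    lebesgue_measure (`[a - b, a + b]%classic : set R) = (2 * b)%:E.
  move=> b0; rewrite lebesgue_measure_itv /= lte_fin.
  case: ltP => [_|ab]; first by rewrite -EFinB; congr EFin; ring.
  by congr EFin; lra.
rewrite product_measure1E//= !L// -EFinM expr2//.
Qed.

(** With [n = size s], the density is at most [4 / q^(2n+2)] on the cell and the box has Lebesgue
    area [(2 K q^n)^2]: the powers of [q^n] cancel. *)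
Lemma hyp_area_cell_le s : 0 < q -> 0 <= K ->
  (hyp_area (cell s) <= ((4 * K / q) ^+ 2)%:E)%E.
Proof.
move=> q0 K0; rewrite /hyp_area; set n := size s.
have qn0 : 0 < q ^+ n.+1 by rewrite exprn_gt0.
apply: (@le_trans _ _
  (\int[lebesgue_measure \x lebesgue_measure]_(z in cell s `&` disc)
    (cst (4 / (q ^+ n.+1) ^+ 2)%:E) z)%E).
  apply: ge0_le_integral => //=.
  - by apply: measurableI; [exact: measurable_cell|exact: measurable_disc].
  - by move=> z _; rewrite lee_fin divr_ge0// sqr_ge0.
  (* Written as a real power, the inverse is measurable by [measurable_powR] without a nonvanishing
     condition. *)
  - apply/measurable_EFinP; apply: (eq_measurable_fun
      (fun z : R * R => 4 * ((1 - sqnorm z) ^+ 2) `^ (- 1))).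
      move=> z _; rewrite powR_inv1// sqr_ge0//.
    apply: measurable_funM; first exact: measurable_cst.
    apply: (measurableT_comp (measurable_powR _)).
    apply: measurable_funX; apply: measurable_funB; first exact: measurable_cst.
    exact: measurable_funTS measurable_sqnorm.
  - move=> z [[/andP[z1 _] _ _] _]; rewrite lee_fin ler_pM2l//.
    rewrite lef_pV2 ?posrE ?exprn_gt0//; last exact: lt_trans z1.
    by rewrite ler_sqr ?nnegrE ltW//; exact: lt_trans z1.
rewrite integral_cst//; last first.
  by apply: measurableI; [exact: measurable_cell|exact: measurable_disc].
apply: (@le_trans _ _ ((4 / (q ^+ n.+1) ^+ 2)%:E *
   (lebesgue_measure \x lebesgue_measure)%E (cell_box s))%E).
  apply: lee_wpmul2l; first by rewrite lee_fin divr_ge0// sqr_ge0.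
  apply: le_measure; rewrite ?inE.
  - by apply: measurableI; [exact: measurable_cell|exact: measurable_disc].
  - exact: measurable_cell_box.
  - by rewrite cellE => z [[]].
rewrite lebesgue2_cell_box// -EFinM lee_fin le_eqVlt.
apply/orP; left; apply/eqP.
rewrite -/n (exprS q n); field.
by rewrite !gt_eqF ?exprn_gt0.
Qed.

End Cells.

(** * Cutsets and percolation on the binary tree *)

(* The families of nodes below [s] of relative depth at most [n] that block
   every path of length [n] from [s]. *)
Fixpoint cutsets n (s : seq bool) : seq (seq (seq bool)) :=
  if n is m.+1 then
    [:: s] :: [seq c1 ++ c2 | c1 <- cutsets m (rcons s false),
                              c2 <- cutsets m (rcons s true)]
  else [:: [:: s]].

Lemma cutsetsS n s : cutsets n.+1 s =
  [:: s] :: [seq c1 ++ c2 | c1 <- cutsets n (rcons s false),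
                            c2 <- cutsets n (rcons s true)].
Proof. by []. Qed.

Lemma cutsets_prefix n s c t : c \in cutsets n s -> t \in c -> prefix s t.
Proof.
elim: n s c => [|n IH] s c /=.
  by rewrite inE => /eqP ->; rewrite inE => /eqP ->; exact: prefix_refl.
rewrite inE => /predU1P[->|].
  by rewrite inE => /eqP ->; exact: prefix_refl.
move=> /allpairsP[[c1 c2] /= [h1 h2 ->]]; rewrite mem_cat => /orP[tc|tc].
  by apply: prefix_trans (IH _ _ h1 tc); exact: prefix_rcons.
by apply: prefix_trans (IH _ _ h2 tc); exact: prefix_rcons.
Qed.

(** Nodes of the two subtrees extend distinct words of equal length. Independence applies only to
    lists without repetition. *)
Lemma cutsets_uniq n s c : c \in cutsets n s -> uniq c.
Proof.
elim: n s c => [|n IH] s c /=; first by rewrite inE => /eqP ->.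
rewrite inE => /predU1P[->//|/allpairsP[[c1 c2] /= [h1 h2 ->]]].
rewrite cat_uniq (IH _ _ h1) (IH _ _ h2) andbT /=.
apply/hasPn => t /(cutsets_prefix h2) p2; apply/negP => /(cutsets_prefix h1).
case/prefixP: p2 => u ->; by rewrite -!cats1 -!catA prefix_catr//= andbF.
Qed.

(** This makes the event that some cutset is bad increase with the depth. *)
Lemma cutsets_incr n s c : c \in cutsets n s -> c \in cutsets n.+1 s.
Proof.
elim: n s c => [|n IH] s c; first by rewrite /= !inE => ->.
rewrite [cutsets n.+2 s]cutsetsS [cutsets n.+1 s]cutsetsS inE => /predU1P[->|].
  by rewrite inE eqxx.
move=> /allpairsP[[c1 c2] /= [h1 h2 ->]]; rewrite in_cons; apply/orP; right.
exact: (allpairs_f cat (IH _ _ h1) (IH _ _ h2)).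
Qed.

(** The root contributes [p] and the concatenations factor into the product of the two subtree sums;
    the bound [2 p] is stable as [p + (2 p)^2 <= 2 p] for [p <= 1/4]. *)
Lemma cutsets_weight (R : realType) (p : R) n s : 0 <= p -> p <= 1 / 4 ->
  0 <= \sum_(c <- cutsets n s) p ^+ size c <= 2 * p.
Proof.
move=> p0 p4; apply/andP; split.
  by apply: sumr_ge0 => c _; exact: exprn_ge0.
elim: n s => [|n IH] s /=.
  by rewrite big_seq1 /= expr1; lra.
rewrite big_cons /= expr1 big_allpairs_dep /=.
have -> : \sum_(c1 <- cutsets n (rcons s false))
    \sum_(c2 <- cutsets n (rcons s true)) p ^+ size (c1 ++ c2) =
  (\sum_(c <- cutsets n (rcons s false)) p ^+ size c) *
  (\sum_(c <- cutsets n (rcons s true)) p ^+ size c).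
  rewrite big_distrl; apply: eq_bigr => c1 _.
  by rewrite big_distrr; apply: eq_bigr => c2 _; rewrite size_cat exprD.
have S0 t : 0 <= \sum_(c <- cutsets n t) p ^+ size c.
  by apply: sumr_ge0 => c _; exact: exprn_ge0.
have := ler_pM (S0 _) (S0 _) (IH (rcons s false)) (IH (rcons s true)).
by move=> ?; nra.
Qed.

(** If [s] is not bad, a good path from either child extends to [s]; otherwise bad cutsets of both
    children concatenate. *)
Lemma cutset_or_path (T : Type) (bad : seq bool -> set T) n s w :
  (exists2 c, c \in cutsets n s & forall t, t \in c -> bad t w) \/
  (exists2 u, size u = n & forall k, (k <= n)%N -> ~ bad (s ++ take k u) w).
Proof.
elim: n s => [|n IH] s.
  have [bs|bs] := pselect (bad s w).
    by left; exists [:: s]; [rewrite inE|move=> t; rewrite inE => /eqP ->].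
  by right; exists [::] => // -[|k]//= _; rewrite cats0.
have [bs|bs] := pselect (bad s w).
  by left; exists [:: s]; [rewrite inE eqxx|move=> t; rewrite inE => /eqP ->].
have step b u : size u = n ->
    (forall k, (k <= n)%N -> ~ bad (rcons s b ++ take k u) w) ->
    exists2 u, size u = n.+1 &
      forall k, (k <= n.+1)%N -> ~ bad (s ++ take k u) w.
  move=> un good; exists (b :: u); first by rewrite /= un.
  by move=> [|k] kn; rewrite /= ?cats0// -cat_rcons; exact: good.
have [[c1 h1 b1]|[u un good]] := IH (rcons s false); last first.
  by right; exact: step good.
have [[c2 h2 b2]|[u un good]] := IH (rcons s true); last first.
  by right; exact: step good.
left; exists (c1 ++ c2).
  by rewrite /= inE; apply/orP; right; apply/allpairsP; exists (c1, c2).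
by move=> t; rewrite mem_cat => /orP[/b1|/b2].
Qed.

(** A union bound over cutsets gives [2 p] at every depth, and continuity from below keeps it for
    the union of the increasing events [B n]. The words obtained for different [n] need not extend
    one another. *)
Lemma tree_percolation (R : realType) d (T : measurableType d)
    (P : probability T R) (bad : seq bool -> set T) (p : R) :
  0 <= p -> p <= 1 / 4 -> (forall s, measurable (bad s)) ->
  (forall c, uniq c ->
    (P (\bigcap_(s in [set` c]) bad s) <= (p ^+ size c)%:E)%E) ->
  exists G : set T, [/\ measurable G, (P G >= (1 - 2 * p)%:E)%E &
    forall w, G w -> forall n,
      exists2 u, size u = n & forall k, (k <= n)%N -> ~ bad (take k u) w].
Proof.
move=> p0 p4 mbad Pbad.
pose cut (c : seq (seq bool)) : set T := \bigcap_(s in [set` c]) bad s.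
have mcut c : measurable (cut c).
  by apply: fin_bigcap_measurable => // s _; exact: mbad.
pose B n : set T := \big[setU/set0]_(c <- cutsets n [::]) cut c.
have BE n w : B n w <->
    exists2 c, c \in cutsets n [::] & forall t, t \in c -> bad t w.
  by rewrite /B -bigcup_seq; split=> -[c cn H]; exists c.
have mB n : measurable (B n) by apply: bigsetU_measurable.
have PB n : (P (B n) <= (2 * p)%:E)%E.
  apply: (@le_trans _ _ (\sum_(c <- cutsets n [::]) (p ^+ size c)%:E)%E).
    rewrite /B; elim: (cutsets n [::]) (@cutsets_uniq n [::]) => [|c l IH] ul.
      by rewrite !big_nil measure0.
    rewrite !big_cons (le_trans (measureU2 _ _ _))//.
      by apply: bigsetU_measurable.
    apply: leeD; first by apply: Pbad; apply: ul; rewrite inE eqxx.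
    by apply: IH => c' cl; apply: ul; rewrite inE cl orbT.
  by rewrite sumEFin lee_fin; have /andP[_] := cutsets_weight n [::] p0 p4.
have ndB : nondecreasing_seq B.
  apply/nondecreasing_seqP => n; apply/subsetPset => w /BE[c cn bc].
  by apply/BE; exists c => //; exact: cutsets_incr.
have mU : measurable (\bigcup_n B n) by exact: bigcupT_measurable.
have PU : (P (\bigcup_n B n) <= (2 * p)%:E)%E.
  have cB := @nondecreasing_cvg_mu _ _ _ P _ mB mU ndB.
  rewrite -(cvg_lim _ cB)//; apply: lime_le.
    by apply/cvg_ex; eexists; exact: cB.
  by apply: nearW => n; exact: PB.
exists (~` (\bigcup_n B n)); split.
- exact: measurableC.
- by rewrite probability_setC// EFinB leeB.
- move=> w nB n; have [H|[u un good]] := cutset_or_path bad n [::] w.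
    by exfalso; apply: nB; exists n => //; apply/BE.
  by exists u.
Qed.

(** * Cells hit by a Poisson process *)

Section Void.
Context {R : realType} d (T : measurableType d) (P : probability T R).
Context d' (S : measurableType d').

Definition hits (x : nat -> T -> S) (A : set S) : set T :=
  [set w | exists n, A (x n w)].

Lemma measurable_hits (x : nat -> {RV P >-> S}) (A : set S) :
  measurable A -> measurable (hits x A).
Proof.
move=> mA; rewrite (_ : hits x A = \bigcup_n (x n @^-1` A)).
  apply: bigcupT_measurable => n; rewrite -[X in measurable X]setTI.
  exact: measurable_funPT.
by apply/seteqP; split=> w /= [n]; [move=> An|move=> _ An]; exists n.
Qed.

Lemma point_count_eq0 (x : nat -> T -> S) (A : set S) w :
  (@point_count R _ _ _ x A w = 0)%E <-> ~ hits x A w.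
Proof.
rewrite /point_count /counting; split=> [|nA].
  (* [counting] is [+oo] on infinite sets, so a zero count forces finiteness. *)
  case: asboolP => // fin [] card0 [n An].
  move/eqP: card0; rewrite pnatr_eq0 finmap.cardfs_eq0 => /eqP.
  move=> /(fset_set_set0 fin) e0; move: An.
  by have : ~ set0 n by []; rewrite -e0.
rewrite (_ : [set n | A (x n w)] = set0); last first.
  by apply/seteqP; split=> // n An; apply: nA; exists n.
by rewrite asboolT// fset_set0.
Qed.

(** The void probability is [exp (- nu A)], and [1 - exp (- a) <= a]. *)
Lemma poisson_hits_le (nu : set S -> \bar R) (x : nat -> {RV P >-> S})
    (A : set S) (p : R) : poisson_process nu x -> measurable A ->
  (0 <= nu A)%E -> (nu A <= p%:E)%E -> (P (hits x A) <= p%:E)%E.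
Proof.
move=> [law _] mA nu0 nup.
have nufin : nu A \is a fin_num.
  by rewrite ge0_fin_numE// (le_lt_trans nup)// ltry.
have := law A 0%N mA; rewrite ltey_eq nufin => /(_ isT).
rewrite expr0 fact0 divr1 mul1r.
rewrite (_ : [set w | _] = ~` hits x A); last first.
  by apply/seteqP; split=> w /=; rewrite point_count_eq0.
rewrite probability_setC; last exact: measurable_hits.
move=> H; rewrite -[P _]fineK ?fin_num_measure//; last exact: measurable_hits.
move: H; rewrite -{1}[P _]fineK ?fin_num_measure//; last exact: measurable_hits.
rewrite -EFinB => -[H]; rewrite lee_fin.
have := expR_ge1Dx (- fine (nu A)).
have : fine (nu A) <= p by rewrite -lee_fin fineK.
lra.
Qed.

(** The independence of the process concerns sequences of disjoint sets, so the family is reindexed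
    by codes in [nat]. *)
Lemma poisson_hits_indep (I : countType) (nu : set S -> \bar R)
    (x : nat -> {RV P >-> S}) (A : I -> set S) (p : R) (c : seq I) :
  poisson_process nu x -> (forall s, measurable (A s)) ->
  (forall s t z, A s z -> A t z -> s = t) ->
  (forall s, 0 <= nu (A s))%E -> (forall s, nu (A s) <= p%:E)%E -> 0 <= p ->
  uniq c ->
  (P (\bigcap_(s in [set` c]) hits x (A s)) <= (p ^+ size c)%:E)%E.
Proof.
move=> pois mA tA nu0 nup p0 uc.
(* [pickle_inv] returns a value only on actual codes, so no set of the family is repeated; the other
   indices get [set0]. *)
pose F k : set S := if @pickle_inv I k is Some s then A s else set0.
have FE s : F (pickle s) = A s by rewrite /F pickleK_inv.
have mF k : measurable (F k) by rewrite /F; case: pickle_inv.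
have tF : trivIset setT F.
  apply/trivIsetP => i j _ _ ij; apply/seteqP; split=> // z [].
  rewrite /F; case Ei: (@pickle_inv I i) => [s|//].
  case Ej: (@pickle_inv I j) => [t|//] zs zt.
  have st := tA _ _ _ zs zt; move: ij.
  have := @pickle_invK I i; have := @pickle_invK I j.
  by rewrite /ocancel Ei Ej /= st => <- <-; rewrite eqxx.
have [law /(_ F mF tF) ind] := pois.
pose E k := hits x (F k).
have uJ : uniq [seq pickle s | s <- c].
  by rewrite map_inj_uniq//; exact: (pcan_inj (@pickleK I)).
have := ind [seq pickle s | s <- c] E uJ; rewrite big_map => H.
rewrite (_ : \bigcap_(s in _) _ =
    \bigcap_(i in [set` [seq pickle s | s <- c]]) E i); last first.
  apply/seteqP; split=> w Hw.
    by move=> _ /mapP[s sc ->]; rewrite /E FE; exact: Hw.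
  move=> s /= sc; have := Hw (pickle s); rewrite /E FE; apply.
  by apply/mapP; exists s.
rewrite H; last first.
  move=> k _; exists (~` [set 0%E]); first exact: measurableC.
  rewrite setTI; apply/seteqP; split=> w /=; rewrite point_count_eq0.
    by move/contrapT.
  by move=> h nh; exact: nh.
elim: c {uc uJ H} => [|s c IH]; first by rewrite big_nil expr0.
rewrite big_cons /= exprS EFinM; apply: lee_pmul => //.
  by apply: prode_ge0.
by rewrite /E FE; apply: poisson_hits_le pois _ _ _.
Qed.
End Void.

(** * From empty cells to infinite visibility *)

Section Visibility.
Context {R : realType}.

Lemma asin_height_itv (q : R) s : 0 < q -> q <= 1 / 16 ->
  [/\ 0 <= asin (height q s) < 2 * pi, sin (asin (height q s)) = height q s &
      cos (asin (height q s)) = width q s].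
Proof.
move=> q0 q1; have /andP[h0 h1] := height_bounds s q0 q1.
have h11 : -1 <= height q s <= 1 by apply/andP; split; lra.
have sh : sin (asin (height q s)) = height q s by rewrite asinK// in_itv.
have p0 := pi_gt0 R.
split=> //; last by rewrite cos_asin.
have a1 := asin_lepi2 h11; have a2 := asin_geNpi2 h11.
apply/andP; split; last by lra.
rewrite leNgt; apply/negP => neg.
have : 0 < sin (- asin (height q s)).
  by apply: sin_gt0_pi; lra.
rewrite sinN sh; lra.
Qed.

(** For each [A], the direction of a good word of suitable length is visible up to [A]: a ball
    blocking it earlier would have its center in the cell of a prefix. The direction may vary with
    [A], because total visibility is a supremum. *)
Lemma total_visibility_infty (q K C : R) (x : nat -> R * R) (r : nat -> R) :
  0 < q -> 10 * expR C + 1 <= K -> 16 * K * q < 1 ->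
  (forall n, disc (x n)) -> (forall n, r n <= C) ->
  (forall n, exists2 u, size u = n &
     forall k, (k <= n)%N -> ~ exists m, cell q K (take k u) (x m)) ->
  total_visibility (\bigcup_n hyp_ball (x n) (r n)) = +oo%E.
Proof.
move=> q0 CK Kq dx rC path; have e0 := expR_gt0 C.
have q1 : q <= 1 / 16.
  by have : q <= K * q; [rewrite ler_peMl; lra|lra].
apply/eqyP => A A0.
(* The factor [4 * expR C] is that of [hyp_ball_shadow]; this [n] places the center of any ball met
   before [A] in a shell of index at most [n]. *)
have [n nA] : exists n, 4 * expR C * q ^+ n.+1 < expR (- A).
  have c0 : 4 * expR C * q ^+ n @[n --> \oo] --> (4 * expR C * 0 : R).
    apply: cvgM; first exact: cvg_cst.
    by apply: cvg_expr; rewrite ger0_norm ?ltW//; lra.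
  have : 4 * expR C * 0 < expR (- A) by rewrite mulr0 expR_gt0.
  move=> /(cvgr_lt _ c0)[n _ Hn]; exists n; exact: (Hn n.+1 (leqnSn n)).
have [u un good] := path n.
have [thb sth cth] := asin_height_itv u q0 q1.
set th := asin _ in thb sth cth.
apply: (@le_trans _ _ (visibility (\bigcup_n hyp_ball (x n) (r n)) th));
    last first.
  by apply: ereal_sup_ubound; exists th => //; rewrite /= in_itv.
apply: le_ereal_inf_tmp => _ [r0 [_ [z [[g ray [t /andP[t0 tr] ->]] hit]]] <-].
have [m _ [dz dist]] := hit.
rewrite lee_fin leNgt; apply/negP => rA.
have dC : hyp_dist (x m) (g t) <= C by exact: le_trans (rC m).
have [b1 b2 b3] := hyp_ball_shadow ray t0 (dx m) dC.
rewrite cth in b2; rewrite sth in b3.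
have tA : expR (- A) < expR (- t) by rewrite ltr_expR; lra.
have deep : q ^+ (size u).+1 < 1 - sqnorm (x m).
  by rewrite un -(@ltr_pM2l _ (4 * expR C)); lra.
have [|k kn ck] := cell_cover q0 q1 CK _ (dx m) deep b2 b3; first by lra.
by apply: (good k); [rewrite -un|exists m].
Qed.

End Visibility.

(** * The probability bound and the limit *)

Section Model.
Context {R : realType} d (T : measurableType d) (P : probability T R).

(** The measurable event bounding the inner probability is the percolation event [G] minus the null
    event that some radius exceeds [C]. *)
Lemma inner_prob_visible_ge (lambda C K q : R) (mu : set R -> \bar R)
    (x : nat -> {RV P >-> (R * R)%type}) (r : nat -> {RV P >-> R}) :
  0 < lambda -> poisson_boolean_model lambda mu x r ->
  mu `]C, +oo[%classic = 0%E ->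
  0 < q -> 10 * expR C + 1 <= K -> 16 * K * q < 1 ->
  lambda * (4 * K / q) ^+ 2 <= 1 / 4 ->
  ((1 - 2 * (lambda * (4 * K / q) ^+ 2))%:E <= inner_prob P
    [set w | total_visibility (occupied x r w) = +oo])%E.
Proof.
move=> l0 [dx pois law _ _] muC q0 CK Kq small; have e0 := expR_gt0 C.
have K1 : 1 <= K by lra.
set p := lambda * _ in small *.
have p0 : 0 <= p by rewrite mulr_ge0 ?sqr_ge0// ltW.
pose nu A := (lambda%:E * @hyp_area R A)%E.
have nu0 s : (0 <= nu (cell q K s))%E.
  apply: mule_ge0; first by rewrite lee_fin ltW.
  by apply: integral_ge0 => z _; rewrite lee_fin divr_ge0// sqr_ge0.
have nup s : (nu (cell q K s) <= p%:E)%E.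
  rewrite EFinM; apply: lee_wpmul2l; first by rewrite lee_fin ltW.
  by apply: hyp_area_cell_le => //; lra.
have [G [mG PG HG]] := @tree_percolation R d T P
  (fun s => hits x (cell q K s)) p p0 small
  (fun s => measurable_hits x (measurable_cell q K s))
  (fun c => poisson_hits_indep pois (measurable_cell q K)
     (fun s t z => @cell_inj R q K s t z q0 K1 Kq) nu0 nup p0).
pose N n := r n @^-1` `]C, +oo[%classic.
have mN n : measurable (N n).
  by rewrite /N -[X in measurable X]setTI; exact: measurable_funPT.
have PN n : P (N n) = 0%E by rewrite -muC -(law n).
have mU : measurable (\bigcup_n N n) by exact: bigcupT_measurable.
have PU : P (\bigcup_n N n) = 0%E.
  apply: measure_negligible => //; apply: negligible_bigcup => n.
  by apply/negligibleP => //; exact: PN.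
apply: (@le_trans _ _ (P (G `\` \bigcup_n N n))).
  rewrite measureD//=; last by rewrite ltey_eq fin_num_measure.
  rewrite (_ : P (G `&` _) = 0%E) ?sube0//.
  apply/eqP; rewrite eq_le measure_ge0 andbT -PU le_measure ?inE//.
  exact: measurableI.
apply: ereal_sup_ubound; exists (G `\` \bigcup_n N n) => //; split.
  exact: measurableD.
move=> w [Gw Nw]; apply: (@total_visibility_infty R q K C) => //.
  move=> n; rewrite leNgt; apply/negP => rC; apply: Nw; exists n => //.
  by rewrite /N /= in_itv /= andbT.
exact: HG.
Qed.

Lemma integral_gt0_ae (f : T -> \bar R) : measurable_fun setT f ->
  {ae P, forall w, (0 < f w)%E} -> (0 < \int[P]_w f w)%E.
Proof.
move=> mf f0.
have fE : (\int[P]_w f w = \int[P]_w `|f w|)%E.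
  apply: ae_eq_integral => //; first exact: measurableT_comp.
  by apply: filterS f0 => w fw _; rewrite gee0_abs// ltW.
rewrite lt_neqAle fE integral_ge0 ?andbT; last by move=> *; exact: abse_ge0.
apply/eqP => /esym/(ae_eq_integral_abs P measurableT mf) f00.
have : {ae P, forall w : T, False}.
  by apply: filterS2 f0 f00 => w fw /(_ I) fw0; move: fw; rewrite fw0 ltxx.
move=> [B [mB PB sB]]; have := probability_setT P.
rewrite (_ : setT = B) ?PB; first by move=> /eqP; rewrite eq_sym onee_eq0.
by apply/seteqP; split=> // w _; apply: sB => /=; apply.
Qed.

End Model.

Lemma sinh_gt0 (R : realType) (x : R) : 0 < x -> 0 < sinh x.
Proof. by move=> x0; rewrite /sinh divr_gt0// subr_gt0 ltr_expR; lra. Qed.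

Lemma measurable_sinh (R : realType) : measurable_fun setT (@sinh R).
Proof.
apply: measurable_funM; last exact: measurable_cst.
apply: measurable_funB; first exact: measurable_expR.
rewrite -[X in measurable_fun _ X]/(@expR R \o (fun x : R => - x)).
apply: measurableT_comp; first exact: measurable_expR.
exact: oppr_measurable.
Qed.

(** The expectation of [sinh] of the radius is positive, so [alpha] is at least a positive multiple
    of [lambda]. *)
Lemma alpha_to_0_small (R : realType) (d : measure_display)
    (T : measurableType d) (P : probability T R) (rad : {RV P >-> R}) (e : R) :
  {ae P, forall w, 0 < rad w} -> 0 < e ->
  alpha_to_0 rad [set lambda | 0 < lambda < e].
Proof.
move=> rad0 e0.
have E0 : (0 < 'E_P[@sinh R \o rad])%E.
  rewrite unlock; apply: integral_gt0_ae.
    apply/measurable_EFinP; apply: measurableT_comp.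
      exact: measurable_sinh.
    exact: measurable_funPT.
  by apply: filterS rad0 => w w0; rewrite lte_fin; exact: sinh_gt0.
(* Only positivity of [rad] is assumed here, so the expectation may be infinite; then [c = 1]
   serves. *)
have [c c0 cE] : exists2 c : R, 0 < c & (c%:E <= 'E_P[@sinh R \o rad])%E.
  move: E0; case: ('E_P[_])%E => [c c0| _|//]; first by exists c.
  by exists 1 => //; rewrite leey.
exists (2 * e * c) => /=; first by rewrite !mulr_gt0.
move=> l /= [l0 al]; rewrite l0 /=.
have : ((2 * l)%:E * c%:E < (2 * e * c)%:E)%E.
  apply: le_lt_trans al; apply: le_trans (lee_abs _).
  by apply: lee_wpmul2l => //; rewrite lee_fin mulr_ge0// ltW.
by rewrite -EFinM lte_fin ltr_pM2r// ltr_pM2l.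
Qed.

Theorem proposition9 (R : realType)
  (d0 : measure_display) (Omega0 : measurableType d0)
  (P0 : probability Omega0 R) (rad : {RV P0 >-> R}) (C : R)
  (hrad : {ae P0, forall w, 0 < rad w <= C})
  (d : R -> measure_display) (Omega : forall lambda, measurableType (d lambda))
  (P : forall lambda, probability (Omega lambda) R)
  (x : forall lambda, nat -> {RV (P lambda) >-> (R * R)%type})
  (r : forall lambda, nat -> {RV (P lambda) >-> R})
  (hmodel : forall lambda, 0 < lambda ->
     poisson_boolean_model lambda (distribution P0 rad) (x lambda) (r lambda)) :
  inner_prob (P lambda)
    [set w | total_visibility (occupied (x lambda) (r lambda) w) = +oo%E]
    @[lambda --> alpha_to_0 rad] --> 1%E.
Proof.
have rad0 : {ae P0, forall w, 0 < rad w} by apply: filterS hrad => w /andP[].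
have muC : distribution P0 rad `]C, +oo[%classic = 0%E.
  rewrite -[LHS]/(P0 (rad @^-1` `]C, +oo[%classic)); apply: measure_negligible.
    by rewrite -[X in measurable X]setTI; exact: measurable_funPT.
  have [B [mB PB sB]] := hrad; exists B; split=> // w Cw.
  apply: sB => /= /andP[_].
  by move: Cw; rewrite /= in_itv /= andbT => /lt_le_trans/[apply]; rewrite ltxx.
have e0 := expR_gt0 C.
(* [K] is the least value allowed by [cell_cover] with [k = 10 * expR C]; the [17] makes
   [16 * K * q < 1] strict. *)
pose K : R := 10 * expR C + 1; pose q : R := (17 * K)^-1.
have K1 : 1 <= K by rewrite /K; lra.
have q0 : 0 < q by rewrite invr_gt0; lra.
have Kq : 16 * K * q < 1 by rewrite /q ltr_pdivrMr; lra.
pose c : R := (4 * K / q) ^+ 2.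
have c0 : 0 < c by rewrite exprn_gt0// divr_gt0//; lra.
move=> V V1.
have /nbhs_ballP[eps /= eps0 epsV] : nbhs (1 : R) (V \o EFin) := V1.
(* The bound [1 / 4] on [lambda * c] is for percolation; [eps / 2] keeps the loss [2 * (lambda * c)]
   below [eps]. *)
have m0 : 0 < Num.min (eps / 2) (1 / 4) / c.
  by rewrite divr_gt0// lt_min !divr_gt0.
suff sub : [set lambda | 0 < lambda < Num.min (eps / 2) (1 / 4) / c] `<=`
    [set lambda | V (inner_prob (P lambda)
    [set w | total_visibility (occupied (x lambda) (r lambda) w) = +oo%E])].
  have [e /= ee sube] := alpha_to_0_small rad0 m0.
  by exists e => // l /sube /sub.
move=> l /= /andP[l0]; rewrite ltr_pdivlMr// lt_min => /andP[leps l4].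
have := inner_prob_visible_ge l0 (hmodel l l0) muC q0 (lexx _) Kq (ltW l4).
have : (inner_prob (P l) [set w | total_visibility
    (occupied (x l) (r l) w) = +oo%E] <= 1)%E.
  by apply: ge_ereal_sup => _ [A [mA _] <-]; exact: probability_le1.
case: inner_prob => [v||//]; last by rewrite leye_eq.
rewrite !lee_fin => v1 vl; apply: (epsV v); rewrite /ball /=.
by rewrite ger0_norm ?subr_ge0//; rewrite -/c in vl; lra.
Qed.
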